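(* (Controllability of the moment system.) Given the moment system $\mathfrak{X}(k+1)=\mathfrak{A}(\mathfrak{U}(k))\,\mathfrak{X}(k)+\mathfrak{U}(k)$ (defined in the context), there exists a $K$, satisfying $K<+\infty$ and $K\in\mathbb{N}_0$, such that an arbitrary initial $\mathfrak{X}(0)\in\mathbb{V}^{2n}_{++}$ can be steered to an arbitrary $\mathfrak{X}_T\in\mathbb{V}^{2n}_{++}$ within $K$ steps, where the states $\mathfrak{X}(k)$ and the controls $\mathfrak{U}(k)$, $k=0,\dots,K-1$, are confined to $\mathbb{V}^{2n}_{++}$.
   Context: The underlying scalar system is $x(k+1)=a(k)x(k)+u(k)$, $k\in\mathbb{N}_0=\{0,1,2,\dots\}$, with $a(k)\in(0,1)$; it is assumed stable, meaning that the equilibrium $x(k)=0$ (of the system without control) is asymptotically and exponentially stable. The state $x(k)$ and the control $u(k)$ are random variables, with $u(k)$ independent of $x(k)$. Moment system: fix a positive integer $n$. The state is $\mathfrak{X}(k)=(\mathbb{E}[x(k)],\mathbb{E}[x^2(k)],\dots,\mathbb{E}[x^{2n}(k)])^T\in\mathbb{R}^{2n}$ and the control is $\mathfrak{U}(k)=(\mathbb{E}[u(k)],\mathbb{E}[u^2(k)],\dots,\mathbb{E}[u^{2n}(k)])^T\in\mathbb{R}^{2n}$. The matrix $\mathfrak{A}(\mathfrak{U}(k))\in\mathbb{R}^{2n\times 2n}$ (which also depends on $k$ through $a(k)$) is lower triangular, with $(l,j)$ entry $\binom{l}{j}a(k)^j\,\mathbb{E}[u^{l-j}(k)]$ for $1\le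 j\le l\le 2n$ (where $\mathbb{E}[u^0(k)]=1$) and $0$ for $j>l$. For $\mathfrak{X}=(\mathfrak{X}_1,\dots,\mathfrak{X}_{2n})^T\in\mathbb{R}^{2n}$, with $\mathfrak{X}_0=1$, $[\mathfrak{X}]_H$ denotes the $(n+1)\times(n+1)$ Hankel matrix with $(i,j)$ entry $\mathfrak{X}_{i+j}$, $0\le i,j\le n$, and $\mathbb{V}^{2n}_{++}=\{\mathfrak{X}\in\mathbb{R}^{2n}:[\mathfrak{X}]_H\succ 0\}$ (positive definite). That $\mathfrak{X}(0)$ can be steered to $\mathfrak{X}_T$ within $K$ steps means that there is a control sequence $(\mathfrak{U}(0),\dots,\mathfrak{U}(K-1))$ for which the trajectory of the moment system starting from $\mathfrak{X}(0)$ satisfies $\mathfrak{X}(K)=\mathfrak{X}_T$.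
   Formalization: The number of steps K is chosen after X(0) and X_T and may depend on both; a single K for all pairs is impossible, since the variance of X(K) is at least (a(0)...a(K-1))^2 times the variance of X(0). *)

(* Defs.v *)
From HB Require Import structures.
From mathcomp Require Import all_boot all_order all_algebra.
From mathcomp Require Import all_classical all_reals all_analysis.

Set Implicit Arguments.
Unset Strict Implicit.
Unset Printing Implicit Defensive.

Import Order.TTheory GRing.Theory Num.Theory.
Import numFieldNormedType.Exports.

Local Open Scope classical_set_scope.
Local Open Scope ring_scope.

(* x is a solution, started at time k0, of the scalar system without control;
   its values before k0 are irrelevant. *)
Definition free_solution (R : realType) (a : nat -> R) (k0 : nat)
    (x : nat -> R) : Prop :=
  forall k : nat, (k0 <= k)%N -> x k.+1 = a k * x k.

Definition lyapunov_stable (R : realType) (a : nat -> R) : Prop :=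
  forall (k0 : nat) (e : R), 0 < e -> exists2 d : R, 0 < d &
    forall x : nat -> R, free_solution a k0 x -> `|x k0| < d ->
      forall k : nat, (k0 <= k)%N -> `|x k| < e.

Definition attractive (R : realType) (a : nat -> R) : Prop :=
  forall k0 : nat, exists2 d : R, 0 < d &
    forall x : nat -> R, free_solution a k0 x -> `|x k0| < d ->
      x k @[k --> \oo] --> (0 : R).

Definition asymptotically_stable (R : realType) (a : nat -> R) : Prop :=
  lyapunov_stable a /\ attractive a.

(* The constants may depend on the initial time, as in the two definitions
   above; the uniform notion implies this one. *)
Definition exponentially_stable (R : realType) (a : nat -> R) : Prop :=
  forall k0 : nat, exists d c r : R, [/\ 0 < d, 0 < c, 0 < r < 1 &
    forall x : nat -> R, free_solution a k0 x -> `|x k0| < d ->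
      forall k : nat, (k0 <= k)%N -> `|x k| <= c * `|x k0| * r ^+ (k - k0)].

(* The moment of order l, for 1 <= l <= m, is stored at index l - 1; the moment
   of order 0 is 1, and orders above m (never used below) get the value 0. *)
Definition moment (R : realType) (m : nat) (X : 'cV[R]_m) (l : nat) : R :=
  if l is l'.+1 then oapp (fun i : 'I_m => X i 0) 0 (insub l') else 1.

Definition hankel (R : realType) (n : nat) (X : 'cV[R]_(2 * n)) :
    'M[R]_(n.+1) :=
  \matrix_(i < n.+1, j < n.+1) moment X (i + j).

Definition posdefmx (R : realType) (m : nat) (M : 'M[R]_m) : Prop :=
  M^T = M /\ forall v : 'cV[R]_m, v != 0 -> 0 < (v^T *m M *m v) 0 0.

Definition Vpp (R : realType) (n : nat) : set 'cV[R]_(2 * n) :=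
  [set X | posdefmx (hankel X)].
Arguments Vpp {R} n _.

(* Rows and columns are numbered from 0 here, hence the successors. *)
Definition momentmx (R : realType) (n : nat) (a : R) (U : 'cV[R]_(2 * n)) :
    'M[R]_(2 * n) :=
  \matrix_(l < 2 * n, j < 2 * n)
    if (j <= l)%N then 'C(l.+1, j.+1)%:R * a ^+ j.+1 * moment U (l.+1 - j.+1)
    else 0.

Fixpoint moment_traj (R : realType) (n : nat) (a : nat -> R)
    (U : nat -> 'cV[R]_(2 * n)) (X0 : 'cV[R]_(2 * n)) (k : nat) :
    'cV[R]_(2 * n) :=
  if k is k'.+1 then
    momentmx (a k') (U k') *m moment_traj a U X0 k' + U k'
  else X0.

(* Only U 0, ..., U K.-1 matter. *)
Definition steerable (R : realType) (n : nat) (a : nat -> R) (K : nat)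
    (X0 XT : 'cV[R]_(2 * n)) : Prop :=
  exists U : nat -> 'cV[R]_(2 * n),
    (forall k : nat, (k < K)%N ->
       Vpp n (moment_traj a U X0 k) /\ Vpp n (U k)) /\
    moment_traj a U X0 K = XT.

(* Main.v *)
Require Import Defs.
From mathcomp Require Import all_boot all_order all_algebra.
From mathcomp Require Import all_classical all_reals all_analysis.
From mathcomp Require Import ring lra zify.
Import Order.TTheory GRing.Theory Num.Theory.
Import numFieldNormedType.Exports.
Local Open Scope classical_set_scope.
Local Open Scope ring_scope.

(** One step of the moment system is a truncated convolution: the moments of
    [a x + u] with [x] and [u] independent are
    [sum_j C(l, j) a^j X_j U_(l - j)] ([moment_step]).  Two facts about it give
    controllability.

    It preserves positive definiteness of the Hankel matrices ([Vpp_step]).  If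
    [hankel U = B B^T], then the form of the new Hankel matrix at the coefficient
    vector of a polynomial [p], that is the integral of [p (a x + y) ^ 2], is a
    sum over the columns of [B] of values of the form of [hankel X].

    It can be inverted in [U]: the unknown [U_l] enters the [l]-th equation with
    coefficient 1, so any target [T] is reached in a single step by some [U].  If
    the moments of [X] of positive order are small, this [U] is close to [T], and
    as positive definiteness is an open condition ([posdef_open]), [U] lies in
    [Vpp] together with [T] ([exact_final_step]).

    It remains to make the moments small by admissible controls
    ([reach_small]).  If [|X_l| <= r^l] and [|U_l| <= s^l] for all [l], the
    binomial theorem gives the bound [(a r + s)^l] after one step; so the radius
    obeys the scalar recursion [r -> a r + s].  The products of the [a k] tend to
    0 by attractivity, which yields a horizon [K] at which the initial radius is
    negligible.  The control is then the target rescaled by a small factor, which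
    leaves [Vpp] invariant and adds at most [K] times its own radius. *)

(** * Positive definite matrices *)

Lemma qformE {R : realType} {m} (M : 'M[R]_m) (v : 'cV[R]_m) :
  (v^T *m M *m v) 0 0 = \sum_i \sum_j v i 0 * v j 0 * M i j.
Proof.
rewrite mxE exchange_big; apply: eq_bigr => j _.
rewrite mxE mulr_suml; apply: eq_bigr => i _.
by rewrite !mxE; ring.
Qed.

Lemma posdef_congr {R : realType} {m} (P M : 'M[R]_m) :
  (forall v : 'cV[R]_m, P *m v = 0 -> v = 0) -> posdefmx M ->
  posdefmx (P^T *m M *m P).
Proof.
move=> Pinj [symM posM]; split=> [|v v0].
  by rewrite !trmx_mul trmxK symM mulmxA.
have Pv0 : P *m v != 0 by apply: contra_neq v0; exact: Pinj.
by have := posM _ Pv0; rewrite trmx_mul !mulmxA.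
Qed.

(** Cholesky factorization, by induction on the size: eliminating the first
    variable is a congruence that splits off a positive pivot and leaves the
    Schur complement, again positive definite. *)
Lemma posdef_gram {R : realType} {m} (M : 'M[R]_m) :
  posdefmx M -> exists B : 'M[R]_m, M = B *m B^T.
Proof.
elim: m M => [|m IH] M pdM; first by exists 0; rewrite [LHS]flatmx0 [RHS]flatmx0.
rewrite -[m.+1]/(1 + m)%N in M pdM *.
have [symM posM] := pdM.
pose a := M 0 0.
pose r : 'rV[R]_m := ursubmx M.
pose N : 'M[R]_m := drsubmx M.
have ulE : ulsubmx M = a%:M.
  by rewrite [LHS]mx11_scalar !mxE /a; congr (M _ _)%:M; apply/val_inj.
have dlE : dlsubmx M = r^T by rewrite -{1}symM -trmx_ursub.
have defM : M = block_mx a%:M r r^T N by rewrite -ulE -dlE submxK.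
have a_gt0 : 0 < a.
  have /posM : delta_mx 0 0 != 0 :> 'cV[R]_(1 + m).
    by apply/eqP => /matrixP/(_ 0 0)/eqP; rewrite !mxE eqxx oner_eq0.
  by rewrite trmx_delta -rowE -colE !mxE.
have an0 : a != 0 by rewrite gt_eqF.
(* Elimination matrix: [P^T M P] is block diagonal with blocks [a] and [S]. *)
pose P : 'M[R]_(1 + m) := block_mx 1%:M (- a^-1 *: r) 0 1%:M.
pose S := N - a^-1 *: (r^T *m r).
have PMP : P^T *m M *m P = block_mx a%:M 0 0 S.
  rewrite defM tr_block_mx !mulmx_block !trmx1 trmx0 !linearZ /=.
  rewrite !(mul1mx, mulmx1, mul0mx, mulmx0, addr0, add0r).
  rewrite mul_scalar_mx mul_mx_scalar -!scalemxAl -?scalemxAr !scalerA.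
  rewrite mulNr mulrN divff // mulVf // !scaleN1r !addNr mul0mx scaler0 add0r.
  by rewrite /S addrC scaleNr.
have Pinj (v : 'cV[R]_(1 + m)) : P *m v = 0 -> v = 0.
  rewrite -[v]vsubmxK mul_block_col mul0mx add0r !mul1mx -[0]vsubmxK !linear0.
  by move=> /eq_col_mx[+ vd0]; rewrite vd0 mulmx0 addr0 => ->.
have [sym' pos'] := posdef_congr _ _ Pinj pdM.
rewrite PMP in sym' pos'.
have /IH[B SB] : posdefmx S.
  split=> [|w w0].
    by move: sym'; rewrite tr_block_mx => /eq_block_mx[].
  have /pos' : col_mx 0 w != 0 :> 'cV[R]_(1 + m).
    by apply: contra_neq w0 => /eqP; rewrite col_mx_eq0 => /andP[_ /eqP].
  rewrite tr_col_mx mul_row_block mul_row_col.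
  by rewrite !(mulmx0, linear0, mul0mx, add0r).
pose s := Num.sqrt a.
have ss : s * s = a by rewrite -expr2 sqr_sqrtr // ltW.
have s0 : s != 0 by rewrite gt_eqF // sqrtr_gt0.
exists (block_mx s%:M 0 (s^-1 *: r^T) B).
rewrite defM tr_block_mx mulmx_block.
rewrite !(mul0mx, mulmx0, addr0, trmx0, tr_scalar_mx, linearZ) /= trmxK.
rewrite -scalar_mxM ss !mul_scalar_mx !mul_mx_scalar.
rewrite -!scalemxAl -?scalemxAr !scalerA divff // mulVf // -invfM ss !scale1r.
by rewrite -SB /S addrC subrK.
Qed.

Lemma qform_norm_le {R : realType} {m} (E : 'M[R]_m) (v : 'cV[R]_m) (d t : R) :
  (forall i j, `|E i j| <= d) -> (forall i, `|v i 0| <= t) ->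
  `|(v^T *m E *m v) 0 0| <= m%:R * m%:R * (t * t * d).
Proof.
move=> Ed vt; rewrite qformE (le_trans (ler_norm_sum _ _ _)) //.
have -> : m%:R * m%:R * (t * t * d) = \sum_(i < m) \sum_(j < m) t * t * d.
  by rewrite !sumr_const !card_ord -mulrnA -[RHS]mulr_natl natrM.
apply: ler_sum => i _; rewrite (le_trans (ler_norm_sum _ _ _)) //.
by apply: ler_sum => j _; rewrite !normrM ler_pM ?mulr_ge0 // ler_pM.
Qed.

(** Writing [M = B B^T], the value [Q] of the form at [v] is the squared length
    of [B^T v], and [v] is recovered linearly from [B^T v]; hence each entry of
    [v] is at most [S sqrt Q].  An entrywise perturbation of [M] by [d] therefore
    changes [Q] by at most a multiple [c d] of [Q] itself. *)
Lemma posdef_open {R : realType} {m} (M : 'M[R]_m) : posdefmx M ->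
  exists2 d : R, 0 < d & forall M' : 'M[R]_m, M'^T = M' ->
    (forall i j, `|M' i j - M i j| <= d) -> posdefmx M'.
Proof.
move=> pdM; have [symM posM] := pdM.
have Munit : M^T \in unitmx.
  rewrite -row_free_unit -kermx_eq0; apply/rowV0P => u /sub_kermxP uM.
  apply/eqP/negPn/negP => u0.
  have /posM : u^T != 0 by rewrite trmx_eq0.
  by rewrite -{1}symM trmxK uM mul0mx mxE ltxx.
have [B MB] := posdef_gram _ pdM.
rewrite symM in Munit.
pose N := invmx M *m B.
have NE (w : 'cV_m) : N *m (B^T *m w) = w.
  by rewrite /N -mulmxA (mulmxA B) -MB mulKmx.
pose S : R := \sum_i \sum_j `|N i j|.
have S0 : 0 <= S by apply: sumr_ge0 => i _; apply: sumr_ge0 => j _.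
pose c : R := m%:R * m%:R * (S * S).
have c0 : 0 <= c by rewrite !mulr_ge0.
(* This radius makes the relative error [c / (1 + c)] strictly less than 1. *)
exists (1 + c)^-1; first by rewrite invr_gt0 ltr_wpDr.
move=> M' symM' M'M; split=> // v v0.
have Q0 := posM v v0; set Q := (v^T *m M *m v) 0 0 in Q0.
pose y := B^T *m v.
have Qy : Q = \sum_j y j 0 ^+ 2.
  rewrite /Q MB mulmxA -mulmxA -[X in X *m _]trmxK trmx_mul trmxK -/y mxE.
  by apply: eq_bigr => j _; rewrite mxE expr2.
have yle j : `|y j 0| <= Num.sqrt Q.
  rewrite -sqrtr_sqr ler_sqrt; last exact: ltW.
  rewrite Qy (bigD1 j) //=. rewrite lerDl.
  by apply: sumr_ge0 => k _; rewrite sqr_ge0.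
have vle i : `|v i 0| <= S * Num.sqrt Q.
  rewrite -{1}(NE v) -/y mxE (le_trans (ler_norm_sum _ _ _)) //.
  have /(ler_wpM2r (sqrtr_ge0 Q)) : \sum_j `|N i j| <= S.
    rewrite /S [leRHS](bigD1 i) //= lerDl.
    by do 2!apply: sumr_ge0 => ? _.
  apply: le_trans.
  rewrite mulr_suml ler_sum // => j _.
  by rewrite normrM ler_wpM2l.
have Qs : Num.sqrt Q * Num.sqrt Q = Q by rewrite -expr2 sqr_sqrtr // ltW.
have ME : v^T *m M' *m v = v^T *m M *m v + v^T *m (M' - M) *m v.
  by rewrite -mulmxDl -mulmxDr addrC subrK.
have dif : `|(v^T *m (M' - M) *m v) 0 0| <= c * (1 + c)^-1 * Q.
  apply: le_trans (qform_norm_le _ _ (1 + c)^-1 _ _ vle) _.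
    by move=> i j; rewrite !mxE.
  rewrite le_eqVlt; apply/orP; left; apply/eqP; rewrite /c.
  move: ((1 + _)^-1) (Num.sqrt Q) Qs => x q <-; move: (m%:R) (S) => k s.
  ring.
rewrite ME mxE -/Q.
have : c * (1 + c)^-1 * Q < Q.
  rewrite gtr_pMl //; move: (c) c0 => x x0.
  by rewrite ltr_pdivrMr ?mul1r ?ltrDr // ltr_wpDr.
move: dif; rewrite ler_norml => /andP[dif _].
move: dif; move: (c * _ * Q) ((v^T *m (M' - M) *m v) 0 0) => x z xz xq.
lra.
Qed.

(** * Binomial sums *)

Definition binsum {R : realType} (l : nat) (G : nat -> R) : R :=
  \sum_(j < l.+1) 'C(l, j)%:R * G j.

Lemma binsum0 {R : realType} (G : nat -> R) : binsum 0 G = G 0.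
Proof. by rewrite /binsum big_ord1 bin0 mul1r. Qed.

Lemma binsumS {R : realType} l (G : nat -> R) :
  binsum l.+1 G = binsum l (fun j => G j + G j.+1).
Proof.
rewrite /binsum.
under [RHS]eq_bigr do rewrite mulrDr.
rewrite big_split /= big_ord_recl bin0.
rewrite (eq_bigr (fun i : 'I_l.+1 =>
    'C(l, i.+1)%:R * G i.+1 + 'C(l, i)%:R * G i.+1));
  last by move=> i _; rewrite lift0 binS natrD mulrDl.
rewrite big_split /= addrA; congr (_ + _).
rewrite [RHS]big_ord_recl bin0 big_ord_recr /= bin_small // mul0r addr0.
by congr (_ + _); apply: eq_bigr => i _; rewrite lift0.
Qed.

Lemma eq_binsum {R : realType} l (F G : nat -> R) :
  (forall j, (j <= l)%N -> F j = G j) -> binsum l F = binsum l G.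
Proof. by move=> FG; apply: eq_bigr => i _; rewrite FG // -ltnS. Qed.

(** A form of the Vandermonde identity valid for any summand [G]; it is
    [(1 + X)^(l + l') = (1 + X)^l (1 + X)^l'] read through the linear functional
    sending [X^j] to [G j]. *)
Lemma binsumD {R : realType} l l' (G : nat -> R) :
  binsum (l + l') G = binsum l (fun j => binsum l' (fun j' => G (j + j')%N)).
Proof.
elim: l G => [|l IH] G; first by rewrite binsum0.
rewrite addSn !binsumS IH; apply: eq_binsum => j _.
by rewrite /binsum -big_split; apply: eq_bigr => i _; rewrite mulrDr.
Qed.

Lemma binsum_widen {R : realType} n l (G : nat -> R) : (l <= n)%N ->
  binsum l G = \sum_(j < n.+1) 'C(l, j)%:R * G j.
Proof.
move=> ln; rewrite /binsum (big_ord_widen n.+1 (fun j => 'C(l, j)%:R * G j)) //.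
rewrite big_mkcond; apply: eq_bigr => i _.
by case: ltnP => // li; rewrite bin_small // mul0r.
Qed.

(** * The moment system as a convolution *)

Definition seqmom {R : realType} m (u : nat -> R) : 'cV[R]_m := \col_i u i.+1.

Lemma moment_seqmom {R : realType} m (u : nat -> R) l :
  u 0%N = 1 -> (l <= m)%N -> moment (seqmom m u) l = u l.
Proof.
case: l => [->//|l] _ lm /=.
by case: insubP => [i _ il|]; rewrite ?lm //= mxE il.
Qed.

Lemma eq_moment {R : realType} m (X Y : 'cV[R]_m) :
  (forall l, (l <= m)%N -> moment X l = moment Y l) -> X = Y.
Proof.
move=> XY; apply/colP => i; have := XY i.+1 (ltn_ord i).
by rewrite /= insubT //= => ltim; rewrite (_ : Sub _ _ = i) //; apply/val_inj.
Qed.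

(** The term [j = 0] of the convolution is the additive [U], and the others are
    the rows of [momentmx]. *)
Lemma moment_step {R : realType} n (a : R) (U X : 'cV[R]_(2 * n)) l :
  (l <= 2 * n)%N ->
  moment (momentmx a U *m X + U) l =
  binsum l (fun j => a ^+ j * moment X j * moment U (l - j)).
Proof.
case: l => [|l] ln; first by rewrite binsum0 /= !mulr1.
rewrite /binsum big_ord_recl bin0 /= !mul1r addrC.
rewrite insubT /= !mxE; congr (_ + _).
rewrite (bigID (fun j : 'I_(2 * n) => (j <= l)%N)) /= addrC big1 ?add0r; last first.
  by move=> j /negbTE jl; rewrite mxE jl mul0r.
rewrite (big_ord_widen (2 * n) (fun j =>
  'C(l.+1, j.+1)%:R * (a ^+ j.+1 * moment X j.+1 * moment U (l.+1 - j.+1)))) //.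
apply: eq_big => // j jl; rewrite mxE /= jl.
rewrite insubT //= => jn; rewrite (_ : Sub _ _ = j); last exact/val_inj.
by rewrite subSS; ring.
Qed.

Lemma Vpp_sym {R : realType} {n} (X : 'cV[R]_(2 * n)) : (hankel X)^T = hankel X.
Proof. by apply/matrixP => i j; rewrite !mxE addnC. Qed.

(** The coefficient of [x^j b_k] in [p (a x + y)], where the powers of [y] are
    expressed by the columns [b_k] of [B], is [v k j].  The form at [p] is then
    the sum over [k] of the form of [hankel X] at [v k].  The entries [v k 0]
    make up [p^T B], which is not zero since [hankel U = B B^T] is positive
    definite; so some summand is positive. *)
Lemma Vpp_step {R : realType} {n} (a : R) (U X : 'cV[R]_(2 * n)) :
  Vpp n X -> Vpp n U -> Vpp n (momentmx a U *m X + U).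
Proof.
move=> [_ posX] pdU; split=> [|p p0]; first exact: Vpp_sym.
have [B UB] := posdef_gram _ pdU.
have [_ posU] := pdU.
(* Rows of [B] are indexed by natural numbers so that [l - j] can be used; for
   [l < j] the row is junk, but it is multiplied by the binomial 0. *)
pose b i k := B (inord i) k.
pose v k : 'cV[R]_n.+1 :=
  \col_(j < n.+1) \sum_(l < n.+1) p l 0 * ('C(l, j)%:R * (a ^+ j * b (l - j)%N k)).
have -> : (p^T *m hankel (momentmx a U *m X + U) *m p) 0 0 =
  \sum_k ((v k)^T *m hankel X *m v k) 0 0.
  rewrite qformE.
  under [RHS]eq_bigr do rewrite qformE.
  transitivity (\sum_k \sum_(l < n.+1) \sum_(l' < n.+1)
     \sum_(i < n.+1) \sum_(j < n.+1)
     (p l 0 * ('C(l, i)%:R * (a ^+ i * b (l - i)%N k))) *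
     (p l' 0 * ('C(l', j)%:R * (a ^+ j * b (l' - j)%N k))) *
     moment X (i + j)); last first.
    apply: eq_bigr => k _.
    under eq_bigr => l _.
      rewrite exchange_big /=.
      under eq_bigr => i _ do rewrite exchange_big /=.
      over.
    rewrite exchange_big /=; apply: eq_bigr => i _.
    rewrite exchange_big /=; apply: eq_bigr => j _.
    rewrite !mxE mulr_suml mulr_suml.
    apply: eq_bigr => l _; rewrite mulr_sumr mulr_suml.
    by apply: eq_bigr.
  rewrite [RHS]exchange_big /=; apply: eq_bigr => l _.
  rewrite [RHS]exchange_big /=; apply: eq_bigr => l' _.
  have := ltn_ord l; have := ltn_ord l'; rewrite !ltnS => l'n ln.
  rewrite mxE moment_step; last lia.
  rewrite binsumD (binsum_widen _ _ _ ln) mulr_sumr [RHS]exchange_big /=.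
  apply: eq_bigr => i _; rewrite (binsum_widen _ _ _ l'n) [RHS]exchange_big /=.
  rewrite !mulr_sumr; apply: eq_bigr => j _.
  case: (leqP i l) => il; last first.
    rewrite bin_small // !mul0r mulr0 big1 // => k _; ring.
  case: (leqP j l') => jl; last first.
    rewrite (bin_small jl) !mul0r !mulr0 big1 // => k _; ring.
  have -> : (l + l' - (i + j) = (l - i) + (l' - j))%N by lia.
  have -> : moment U ((l - i) + (l' - j)) = \sum_k b (l - i)%N k * b (l' - j)%N k.
    have /matrixP/(_ (inord (l - i)) (inord (l' - j))) := UB.
    rewrite !mxE !inordK; try lia.
    by move=> ->; apply: eq_bigr => k _; rewrite mxE.
  rewrite !mulr_sumr; apply: eq_bigr => k _.
  by rewrite exprD; ring.
have posv k : 0 <= ((v k)^T *m hankel X *m v k) 0 0.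
  by have [->|/posX/ltW//] := eqVneq (v k) 0; rewrite mulmx0 mxE.
have [k vk] : exists k, v k != 0.
  apply: contrapT => /forallNP v0.
  have pB : p^T *m B = 0.
    apply/rowP => k; have /negP/negPn/eqP/colP/(_ 0) := v0 k.
    rewrite !mxE => v0k; rewrite -[RHS]v0k; apply: eq_bigr => l _.
    by rewrite mxE /b subn0 bin0 expr0 !mul1r inord_val.
  by have := posU p p0; rewrite UB mulmxA pB !mul0mx mxE ltxx.
rewrite (bigD1 k) //= ltr_wpDr ?posX //.
by apply: sumr_ge0 => i _.
Qed.

(** These are the moments of [s x]; the Hankel matrix undergoes the congruence by
    the diagonal matrix of the powers of [s]. *)
Lemma Vpp_scale {R : realType} {n} (s : R) (X : 'cV[R]_(2 * n)) : s != 0 ->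
  Vpp n X -> Vpp n (seqmom (2 * n) (fun l => s ^+ l * moment X l)).
Proof.
move=> s0 XV.
pose D := diag_mx (\row_(i < n.+1) s ^+ i).
suff -> : Vpp n (seqmom (2 * n) (fun l => s ^+ l * moment X l)) =
    posdefmx (D^T *m hankel X *m D).
  apply: posdef_congr => // v /matrixP Dv; apply/colP => i.
  have := Dv i 0; rewrite mul_diag_mx !mxE => /eqP.
  by rewrite mulf_eq0 expf_eq0 (negbTE s0) andbF => /eqP.
congr posdefmx; apply/matrixP => i j.
have := ltn_ord i; have := ltn_ord j => jn li.
rewrite /D tr_diag_mx mul_diag_mx mul_mx_diag !mxE moment_seqmom
  ?expr0 ?mul1r //; last lia.
by rewrite exprD; ring.
Qed.

(** * Geometric bounds on the moments *)

(** The geometric shape of the bound is what makes it propagate under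
    convolution with constant exactly 1. *)
Definition moment_bound {R : realType} {m} (rho : R) (X : 'cV[R]_m) :=
  forall l, (l <= m)%N -> `|moment X l| <= rho ^+ l.

Lemma moment_bound_exists {R : realType} {m} (X : 'cV[R]_m) :
  exists2 rho : R, 0 < rho & moment_bound rho X.
Proof.
pose rho : R := 1 + \sum_i `|X i 0|.
have s0 : 0 <= \sum_i `|X i 0| by exact: sumr_ge0.
have rho1 : 1 <= rho by rewrite lerDl.
exists rho; first exact: lt_le_trans rho1.
case=> [|l] lm; first by rewrite normr1.
rewrite /= insubT /=; apply: (@le_trans _ _ rho); last by rewrite ler_eXnr.
rewrite /rho (bigD1 (Ordinal lm)) //= addrCA lerDl addr_ge0 //.
exact: sumr_ge0.
Qed.

Lemma moment_bound_le {R : realType} {m} (r r' : R) (X : 'cV[R]_m) :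
  0 <= r -> r <= r' -> moment_bound r X -> moment_bound r' X.
Proof.
move=> r0 rr' Xr l /Xr/le_trans; apply.
by rewrite lerXn2r ?nnegrE // (le_trans r0).
Qed.

(** The triangle inequality turns the convolution of the two geometric sequences
    into the binomial expansion of [(a r + s)^l]. *)
Lemma moment_bound_step {R : realType} {n} (a r s : R) (U X : 'cV[R]_(2 * n)) :
  0 <= a -> moment_bound r X -> moment_bound s U ->
  moment_bound (a * r + s) (momentmx a U *m X + U).
Proof.
move=> a0 Xr Us l ln; rewrite moment_step // /binsum addrC exprDn.
apply: le_trans (ler_norm_sum _ _ _) _; apply: ler_sum => j _.
have jl : (j <= l)%N by rewrite -ltnS.
rewrite !normrM normr_nat -[leRHS]mulr_natl ler_wpM2l // normrX ger0_norm //.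
rewrite exprMn mulrC ler_pM ?mulr_ge0 ?exprn_ge0 //; first by rewrite Us //; lia.
by rewrite ler_wpM2l ?exprn_ge0 // Xr //; lia.
Qed.

(** * Trajectories *)

Lemma traj_Vpp {R : realType} {n} (a : nat -> R) (U : nat -> 'cV[R]_(2 * n)) X0 k :
  Vpp n X0 -> (forall i, (i < k)%N -> Vpp n (U i)) -> Vpp n (moment_traj a U X0 k).
Proof.
move=> X0V; elim: k => //= k IH UV.
by apply: Vpp_step; [apply: IH => i ik; apply: UV; lia | exact: UV].
Qed.

Lemma traj_ext {R : realType} {n} (a : nat -> R)
    (U U' : nat -> 'cV[R]_(2 * n)) X0 k :
  (forall i, (i < k)%N -> U i = U' i) ->
  moment_traj a U X0 k = moment_traj a U' X0 k.
Proof.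
by elim: k => //= k IH UU'; rewrite IH ?UU' // => i ik; apply: UU'; lia.
Qed.

Lemma traj_bound {R : realType} {n} (a : nat -> R) (V X0 : 'cV[R]_(2 * n)) r s k :
  (forall i, 0 < a i < 1) -> 0 <= r -> 0 <= s ->
  moment_bound r X0 -> moment_bound s V ->
  moment_bound ((\prod_(i < k) a i) * r + k%:R * s) (moment_traj a (fun=> V) X0 k).
Proof.
move=> a01 r0 s0 Xr Vs; elim: k => [|k IH] /=.
  by rewrite big_ord0 mul1r mul0r addr0.
have /andP[ak0 ak1] := a01 k.
have p0 : 0 <= \prod_(i < k) a i.
  by apply: prodr_ge0 => i _; case/andP: (a01 i) => /ltW.
apply: moment_bound_le (moment_bound_step _ _ _ _ _ (ltW ak0) IH Vs).
  by rewrite addr_ge0 // mulr_ge0 ?(ltW ak0) // addr_ge0 ?mulr_ge0.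
rewrite big_ord_recr /= mulrDr -addrA mulrA [a k * _]mulrC lerD2l.
rewrite -natr1 mulrDl mul1r lerD2r.
by rewrite ler_piMl ?mulr_ge0 // ltW.
Qed.

(** The partial products, scaled by half the attraction radius, are themselves a
    free solution. *)
Lemma prod_small {R : realType} (a : nat -> R) (e : R) : attractive a -> 0 < e ->
  exists K, \prod_(i < K) a i < e.
Proof.
move=> /(_ 0%N)[d d0 atr] e0.
pose x k := d / 2 * \prod_(i < k) a i.
have d2 : 0 < d / 2 by rewrite divr_gt0.
have x_free : free_solution a 0 x.
  by move=> k _; rewrite /x big_ord_recr /=; ring.
have : x k @[k --> \oo] --> (0 : R).
  apply: atr => //; rewrite /x big_ord0 mulr1 gtr0_norm //; lra.
move=> /cvgr0_norm_lt /(_ (d / 2 * e) (mulr_gt0 d2 e0)) [K _ /(_ K (leqnn K))] /=.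
rewrite /x normrM gtr0_norm // ltr_pM2l // => /(le_lt_trans (ler_norm _)) KP.
by exists K.
Qed.

(** * Inverting the convolution *)

(** The unknown [u l] enters the [l]-th equation with coefficient [b 0 = 1], so
    the system is solved recursively. *)
Lemma deconv_exists {R : realType} (b T : nat -> R) N : b 0%N = 1 -> T 0%N = 1 ->
  exists u : nat -> R, u 0%N = 1 /\
    forall l, (l <= N)%N -> binsum l (fun j => b j * u (l - j)%N) = T l.
Proof.
move=> b0 T0; elim: N => [|N [u [u0 uT]]].
  exists (fun=> 1); split=> // l; rewrite leqn0 => /eqP->.
  by rewrite binsum0 b0 T0 mulr1.
pose u' l := if (l <= N)%N then u l else
  T N.+1 - \sum_(j < N.+1) 'C(N.+1, j.+1)%:R * (b j.+1 * u (N.+1 - j.+1)%N).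
exists u'; split=> [|l]; first by rewrite /u' leq0n.
rewrite leq_eqVlt => /orP[/eqP->|lN].
  rewrite /binsum big_ord_recl bin0 b0 !mul1r subn0 {1}/u' ltnn.
  rewrite -addrA -sumrN -big_split /= big1 ?addr0 // => j _.
  rewrite /u' /bump leq0n add1n ifT; last lia.
  by rewrite addNr.
rewrite -(uT l) //; apply: eq_binsum => j jl.
by rewrite /u' ifT //; lia.
Qed.

(** The equation for [u l] reads [u l - T l = - sum_(j >= 1) C(l, j) b j u (l-j)],
    and the binomials sum to at most [2^N].  The smallness of [d 2^N] keeps [u]
    below [2 tau], which is the bound that the induction carries along. *)
Lemma deconv_close {R : realType} (b T u : nat -> R) N (tau d : R) : b 0%N = 1 ->
  (forall j, (0 < j <= N)%N -> `|b j| <= d) ->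
  (forall l, (l <= N)%N -> `|T l| <= tau) ->
  (forall l, (l <= N)%N -> binsum l (fun j => b j * u (l - j)%N) = T l) ->
  d * 2 ^+ N <= 2^-1 -> 0 <= d ->
  forall l, (l <= N)%N -> `|u l - T l| <= d * 2 ^+ N * (2 * tau).
Proof.
move=> b0 bd Ttau uT dN d0.
have tau0 : 0 <= tau by rewrite (le_trans _ (Ttau 0%N _)).
suff H l : (l <= N)%N ->
    `|u l - T l| <= d * 2 ^+ N * (2 * tau) /\ `|u l| <= 2 * tau.
  by move=> l /H[].
have [m lm] := ubnP l; elim: m l lm => // m IH l lm lN.
have ul : `|u l - T l| <= d * 2 ^+ N * (2 * tau).
  rewrite -(uT l lN) /binsum big_ord_recl bin0 b0 !mul1r subn0 opprD addNKr normrN.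
  apply: le_trans (ler_norm_sum _ _ _) _.
  have -> : d * 2 ^+ N * (2 * tau) = (2 ^+ N) * (d * (2 * tau)) by ring.
  apply: (@le_trans _ _ (\sum_(j < l) 'C(l, j.+1)%:R * (d * (2 * tau)))).
    apply: ler_sum => j _; rewrite lift0 !normrM normr_nat ler_wpM2l //.
    have := ltn_ord j => jl.
    rewrite ler_pM // ?bd; try lia.
    by apply: (IH _ _ _).2; lia.
  rewrite -mulr_suml ler_wpM2r ?mulr_ge0 // -natr_sum -natrX ler_nat.
  rewrite (leq_trans _ (leq_pexp2l _ lN)) //.
  have := expnDn 1 1 l; rewrite big_ord_recl bin0 => ->.
  rewrite -[leqLHS]add0n leq_add //; apply: leq_sum => j _.
  by rewrite lift0 !exp1n !muln1.
split=> //; have := Ttau l lN.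
have : d * 2 ^+ N * (2 * tau) <= 2^-1 * (2 * tau) by rewrite ler_wpM2r ?mulr_ge0.
rewrite mulKf // => h1 h2.
rewrite -[u l](subrK (T l)); apply: le_trans (ler_normD _ _) _; lra.
Qed.

(** * Steering *)

(** The tolerance [e] is uniform in [a] and [X], so that it can be fixed before
    the time at which the last step is taken. *)
Lemma exact_final_step {R : realType} {n} (T : 'cV[R]_(2 * n)) : Vpp n T ->
  exists2 e : R, 0 < e & forall (a : R) (X : 'cV[R]_(2 * n)), 0 <= a <= 1 ->
    moment_bound e X -> exists2 U, Vpp n U & momentmx a U *m X + U = T.
Proof.
move=> TV; have [eta eta0 Teta] := posdef_open _ TV.
have [r r0 Tr] := moment_bound_exists T.
(* The base [1 + r] makes the powers increasing, hence a bound common to all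
   orders. *)
pose tau := (1 + r) ^+ (2 * n).
have r1 : 1 <= 1 + r by rewrite lerDl ltW.
have tau0 : 0 < tau by rewrite exprn_gt0 // addr_gt0.
have Ttau l : (l <= 2 * n)%N -> `|moment T l| <= tau.
  move=> ln; apply: le_trans (_ : (1 + r) ^+ l <= _); last exact: ler_weXn2l.
  by apply: moment_bound_le Tr _ ln; rewrite ?lerDr // ltW.
pose mu := Num.min 2^-1 (eta / (2 * tau)).
have mu0 : 0 < mu by rewrite lt_min invr_gt0 ltr0n divr_gt0 // mulr_gt0.
pose d := mu / 2 ^+ (2 * n).
have d0 : 0 < d by rewrite divr_gt0 // exprn_gt0.
have dmu : d * 2 ^+ (2 * n) = mu by rewrite divfK // expf_neq0.
exists (Num.min d 1); first by rewrite lt_min d0 ltr01.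
move=> a X /andP[a0 a1] Xe.
pose b j := a ^+ j * moment X j.
have b0 : b 0%N = 1 by rewrite /b mulr1.
have [u [u0 uT]] := deconv_exists b (moment T) (2 * n) b0 erefl.
have bd j : (0 < j <= 2 * n)%N -> `|b j| <= d.
  move=> /andP[j0 jn]; rewrite normrM ger0_norm ?exprn_ge0 //.
  apply: (@le_trans _ _ (1 * Num.min d 1)); last by rewrite mul1r ge_min lexx.
  rewrite ler_pM ?exprn_ge0 ?exprn_ile1 //; apply: le_trans (Xe j jn) _.
  by rewrite ler_iXnr // ?ge_min ?lexx ?orbT // le_min (ltW d0) ler01.
have uclose l : (l <= 2 * n)%N -> `|u l - moment T l| <= eta.
  move=> ln.
  apply: le_trans (deconv_close _ _ _ _ _ _ b0 bd Ttau uT _ (ltW d0) _ ln) _.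
    by rewrite dmu ge_min lexx.
  by rewrite dmu -ler_pdivlMr ?mulr_gt0 // ge_min lexx orbT.
exists (seqmom (2 * n) u).
  apply: Teta; first exact: Vpp_sym.
  move=> i j; have := ltn_ord i; have := ltn_ord j => jn ni.
  rewrite !mxE moment_seqmom //; last lia.
  by apply: uclose; lia.
apply: eq_moment => l ln; rewrite moment_step // -uT //.
by apply: eq_binsum => j jl; rewrite moment_seqmom //; lia.
Qed.

(** Half of [e] is left for the initial state, damped by the product of the
    [a i], and half for the accumulated controls; [K] is chosen first, and the
    scaling factor [s] of the control afterwards. *)
Lemma reach_small {R : realType} {n} (a : nat -> R) (X0 T : 'cV[R]_(2 * n))
    (e : R) :
  (forall k, 0 < a k < 1) -> attractive a -> Vpp n T -> 0 < e ->
  exists K (V : 'cV[R]_(2 * n)), Vpp n V /\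
    moment_bound e (moment_traj a (fun=> V) X0 K).
Proof.
move=> a01 atr TV e0.
have [r0 r00 Xr] := moment_bound_exists X0.
have [r1 r10 Tr] := moment_bound_exists T.
have e2 : 0 < e / 2 by rewrite divr_gt0.
have [K aK] := prod_small a (e / 2 / r0) atr (divr_gt0 e2 r00).
(* Dividing by [K.+1] instead of [K] covers [K = 0]. *)
pose s := e / 2 / (K.+1%:R * r1).
have s0 : 0 < s by rewrite divr_gt0 // mulr_gt0.
exists K, (seqmom (2 * n) (fun l => s ^+ l * moment T l)).
split; first by apply: Vpp_scale => //; rewrite gt_eqF.
have Vs : moment_bound (s * r1) (seqmom (2 * n) (fun l => s ^+ l * moment T l)).
  move=> l ln; rewrite moment_seqmom // ?mulr1 //.
  rewrite normrM normrX (gtr0_norm s0) [leRHS]exprMn.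
  by rewrite ler_wpM2l ?exprn_ge0 ?Tr // ltW.
have s1 : 0 <= s * r1 by rewrite mulr_ge0 ?ltW.
have p0 : 0 <= \prod_(i < K) a i.
  by apply: prodr_ge0 => i _; case/andP: (a01 i) => /ltW.
have bnd := traj_bound _ _ _ _ _ K a01 (ltW r00) s1 Xr Vs.
apply: moment_bound_le bnd.
  by apply: addr_ge0; apply: mulr_ge0 => //; exact: ltW.
rewrite [leRHS](splitr e) lerD //.
  by rewrite -ler_pdivlMr //; exact: ltW.
have -> : s * r1 = e / 2 / K.+1%:R.
  by rewrite /s invfM mulrA divfK // gt_eqF.
by rewrite mulrCA ler_piMr ?(ltW e2) // ler_pdivrMr ?mul1r ?ler_nat.
Qed.

Theorem theorem2p2 (R : realType) (n : nat) (a : nat -> R)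
    (n_gt0 : (0 < n)%N)
    (a01 : forall k : nat, 0 < a k < 1)
    (a_asym : asymptotically_stable a)
    (a_exp : exponentially_stable a)
    (X0 XT : 'cV[R]_(2 * n)) (X0V : Vpp n X0) (XTV : Vpp n XT) :
  exists K : nat, steerable a K X0 XT.
Proof.
have [e e0 final] := exact_final_step _ XTV.
have [K [V [VV small]]] := reach_small _ X0 _ _ a01 a_asym.2 XTV e0.
have [|W WV WT] := final (a K) _ _ small.
  by have /andP[/ltW-> /ltW->] := a01 K.
pose U k := if (k < K)%N then V else W.
have UV k : Vpp n (U k) by rewrite /U; case: ifP.
exists K.+1, U; split=> [k _|]; first by split=> //; exact: traj_Vpp.
rewrite /= (traj_ext _ U (fun=> V)) ?{1 2}/U ?ltnn //.
by move=> i iK; rewrite /U iK.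
Qed.
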